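(* Let $z\in\mathbb{C}\setminus(-\infty,-1]$ and write $z=x+iy=re^{i\theta}$ with $x,y,\theta\in\mathbb{R}$ and $r\ge0$. Then $$\operatorname{Li}_2(-z)=-\int_0^1\frac{\ln\bigl(1+2xt+t^2(x^2+y^2)\bigr)}{2t}\,dt-i\int_0^1\frac{2}{t}\arctan\!\left(\frac{yt}{1+xt+\sqrt{1+2xt+t^2(x^2+y^2)}}\right)dt,$$ or, equivalently, $$\operatorname{Li}_2(-z)=-\int_0^1\frac{\ln(1+2rt\cos\theta+t^2r^2)}{2t}\,dt-i\int_0^1\frac{2}{t}\arctan\!\left(\frac{rt\sin\theta}{1+rt\cos\theta+\sqrt{1+2rt\cos\theta+t^2r^2}}\right)dt.$$
   Context: $\operatorname{Li}_2(w)=\sum_{n\ge1}w^n/n^2$ for $|w|\le1$. It is extended to $w\in\mathbb{C}\setminus[1,\infty)$ by analytic continuation, given for $z\in\mathbb{C}\setminus(-\infty,-1]$ by $$\operatorname{Li}_2(-z)=-\int_0^1\frac{\log(1+zt)}{t}\,dt,$$ where $\log$ is the principal branch of the complex logarithm, $\log w=\ln|w|+i\operatorname{Arg}(w)$ with $-\pi<\operatorname{Arg}(w)\le\pi$. Here $\ln$ is the real natural logarithm and $\arctan$ is the real arctangent with values in $(-\frac{\pi}{2},\frac{\pi}{2})$. *)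

(* Defs.v *)
(* Stdlib reals with Coquelicot *)
From Stdlib Require Import Reals Lra.
From Coquelicot Require Import Coquelicot.
Open Scope R_scope.

(* Principal argument, in (-PI, PI]; see [Carg_bound] and [Carg_polar].
   The value at 0 is irrelevant. *)
Definition Carg (w : C) : R :=
  if Rle_dec 0 (Im w) then acos (Re w / Cmod w) else - acos (Re w / Cmod w).

(* Principal branch of the logarithm on the nonzero complex numbers. *)
Definition Clog (w : C) : C := (ln (Cmod w), Carg w).

Definition CSeries (a : nat -> C) : C :=
  @iota C_R_CompleteNormedModule (@is_series R_AbsRing C_R_CompleteNormedModule a).

Definition CRInt (f : R -> C) (a b : R) : C :=
  @RInt C_R_CompleteNormedModule f a b.

(* The series on the closed unit disc (summed from n = 0, hence the shift),
   and its analytic continuation, given by the integral with z = - w,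
   elsewhere.  The half-line (1, +oo) is outside the domain.  The integrand has a removable
   singularity at t = 0; its value there does not affect the integral. *)
Definition Li2 (w : C) : C :=
  if Rle_dec (Cmod w) 1 then
    CSeries (fun n => Cdiv (Cpow w (S n)) (RtoC (INR (S n) ^ 2)))
  else
    Copp (CRInt (fun t => Cdiv (Clog (1 + - w * t)%C) (RtoC t)) 0 1).

Definition on_cut (z : C) : Prop := Im z = 0 /\ Re z <= -1.

Lemma Re_div_Cmod_bound (w : C) : w <> 0 -> -1 <= Re w / Cmod w <= 1.
Proof.
intros Hw.
assert (Hp : 0 < Cmod w) by (apply Cmod_gt_0; exact Hw).
assert (Hr : Rabs (Re w) <= Cmod w).
{ destruct w as [u v]; exact (Rle_trans _ _ _ (Rmax_l _ _) (Rmax_Cmod (u, v))). }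
destruct (Rabs_le_between (Re w) (Cmod w)) as [H _]; specialize (H Hr).
split.
- apply Rmult_le_reg_r with (Cmod w); [exact Hp|].
  unfold Rdiv; rewrite Rmult_assoc, Rinv_l by lra; lra.
- apply Rmult_le_reg_r with (Cmod w); [exact Hp|].
  unfold Rdiv; rewrite Rmult_assoc, Rinv_l by lra; lra.
Qed.

Lemma Carg_polar (w : C) : w <> 0 ->
  w = (Cmod w * cos (Carg w), Cmod w * sin (Carg w)).
Proof.
intros Hw.
pose proof (Re_div_Cmod_bound w Hw) as Hb.
assert (Hp : 0 < Cmod w) by (apply Cmod_gt_0; exact Hw).
assert (Hs : Cmod w * sqrt (1 - Rsqr (Re w / Cmod w)) = Rabs (Im w)).
{ rewrite <- (sqrt_Rsqr (Cmod w)) at 1 by lra.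
  rewrite <- sqrt_mult_alt by apply Rle_0_sqr.
  rewrite <- sqrt_Rsqr_abs; f_equal.
  replace (Rsqr (Cmod w) * (1 - Rsqr (Re w / Cmod w)))
    with (Rsqr (Cmod w) - Rsqr (Re w)) by (unfold Rsqr; field; lra).
  unfold Cmod at 1; rewrite Rsqr_sqrt.
  - destruct w as [u v]; unfold Rsqr; simpl; ring.
  - apply Rplus_le_le_0_compat; apply pow2_ge_0. }
unfold Carg; destruct (Rle_dec 0 (Im w)) as [Hi|Hi].
- rewrite cos_acos, sin_acos, Hs, Rabs_pos_eq by lra.
  destruct w as [u v]; f_equal; simpl; field; lra.
- rewrite cos_neg, sin_neg, cos_acos, sin_acos by lra.
  rewrite Ropp_mult_distr_r_reverse, Hs, Rabs_left by lra.
  destruct w as [u v]; f_equal; simpl; [field|ring]; lra.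
Qed.

Lemma Carg_bound (w : C) : w <> 0 -> - PI < Carg w <= PI.
Proof.
intros Hw; pose proof PI_RGT_0.
pose proof (acos_bound (Re w / Cmod w)) as Hb.
pose proof (Carg_polar w Hw) as Hpol; revert Hpol.
unfold Carg; destruct (Rle_dec 0 (Im w)) as [Hi|Hi]; intros Hpol; [lra|].
split; [|lra].
destruct (Req_dec (acos (Re w / Cmod w)) PI) as [He|He]; [|lra].
rewrite He, sin_neg, sin_PI in Hpol.
apply (f_equal Im) in Hpol; simpl in Hpol; unfold Im in *; simpl in *; lra.
Qed.

(* Main.v *)
Require Import Defs.
From Stdlib Require Import Reals Lra Lia.
From Coquelicot Require Import Coquelicot.
Open Scope R_scope.

(** Off the cut, the segment from [1] to [1 + z] stays in the slit plane, where
    [log (1 + z t)] is the pair of its modulus part [ln |1 + z t|] and its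
    argument.  The half-angle formula [Arg (a + i b) = 2 atan (b / (a + |a + i b|))]
    puts the argument in the stated form ([Carg_half_angle], [Clog_segment]).  When
    [|z| > 1] the dilogarithm is the integral of [log (1 + z t) / t] up to sign, and
    taking components gives the result; the integrals exist because a
    differentiable function vanishing at [0] stays continuous after division by [t].

    When [|z| <= 1] the dilogarithm is the series, and the identity between the
    series and the integral has to be proved, including on the unit circle.  With
    [w = - z], the derivative of [- log (1 - w t)] is [w / (1 - w t)], which differs
    from its [N]-th geometric partial sum by [w ^ (N + 2) t ^ (N + 1) / (1 - w t)]
    ([geometric_remainder]).  Since [z <> -1], the denominator is bounded below on the
    whole closed segment, so this is at most [M t ^ (N + 1)].  By the mean value
    theorem the same bound holds for the remainder of [- log (1 - w t) / t], and its
    integral is [O (1 / N)] ([is_series_RInt_div_id]).  The bound is uniform up to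
    [t = 1], so the unit circle is covered by the same argument as the interior.

    All differentiation and integration is done on real and imaginary parts; only
    the geometric identity is complex.  The polar form is the Cartesian one with
    [x = r cos theta] and [y = r sin theta]. *)

(** * Integrals of the form [f t / t] *)

(** The quotient extends continuously to [0] by the derivative there, and one
    point does not affect integrability. *)
Lemma ex_RInt_div_id (f df : R -> R) :
  f 0 = 0 ->
  (forall t, 0 <= t <= 1 -> is_derive f t (df t)) ->
  ex_RInt (fun t => f t / t) 0 1.
Proof.
intros f0 Hf.
apply ex_RInt_ext with (fun t => if Req_EM_T t 0 then df 0 else f t / t).
{ intros t; rewrite Rmin_left, Rmax_right by lra; intros Ht.
  destruct (Req_EM_T t 0); [lra|reflexivity]. }
apply (ex_RInt_continuous (V := R_CompleteNormedModule)).
intros t; rewrite Rmin_left, Rmax_right by lra; intros Ht.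
destruct (Req_dec t 0) as [->|Hn].
- apply continuity_pt_filterlim.
  intros eps Heps.
  assert (H0 := Hf 0 Ht); apply is_derive_Reals in H0.
  destruct (H0 eps Heps) as [delta Hd].
  exists delta; split; [apply cond_pos|].
  intros h [[_ Hh] Hdist]; simpl in *; unfold R_dist in *.
  destruct (Req_EM_T 0 0) as [_|]; [|lra].
  destruct (Req_EM_T h 0) as [->|Hh0]; [lra|].
  rewrite Rminus_0_r in Hdist.
  specialize (Hd h Hh0 Hdist); rewrite Rplus_0_l, f0, Rminus_0_r in Hd.
  exact Hd.
- apply (continuous_ext_loc _ (fun s => f s / s)).
  + assert (Hpos : 0 < t) by lra.
    exists (mkposreal t Hpos); intros s Hs.
    destruct (Req_EM_T s 0) as [->|]; [|reflexivity].
    unfold ball in Hs; simpl in Hs; unfold AbsRing_ball, abs, minus, plus, opp in Hs;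
      simpl in Hs; rewrite Rplus_0_l, Rabs_Ropp, Rabs_pos_eq in Hs; lra.
  + apply (ex_derive_continuous (V := R_NormedModule) (fun s => f s / s)).
    apply (ex_derive_div f (fun s => s)); [eexists; apply Hf; lra| |exact Hn].
    auto_derive; trivial.
Qed.

Lemma is_RInt_pow_unit (n : nat) : is_RInt (fun t => t ^ n) 0 1 (/ INR (S n)).
Proof.
assert (HS := lt_0_INR (S n) (Nat.lt_0_succ n)).
replace (/ INR (S n)) with (minus (1 ^ S n / INR (S n)) (0 ^ S n / INR (S n))).
2: { unfold minus, plus, opp; simpl opp; rewrite pow1, pow_i by lia.
     simpl; unfold Rdiv; ring. }
apply (is_RInt_derive (V := R_CompleteNormedModule) (fun t => t ^ S n / INR (S n))).
- intros t _; auto_derive; [trivial|].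
  simpl pred; field; apply Rgt_not_eq; exact HS.
- intros t _; apply (ex_derive_continuous (V := R_NormedModule) (fun t => t ^ n)).
  auto_derive; trivial.
Qed.

Lemma is_RInt_sum_pow_unit (a : nat -> R) (N : nat) :
  is_RInt (fun t => sum_n (fun k => a k * t ^ k) N) 0 1
    (sum_n (fun k => a k / INR (S k)) N).
Proof.
induction N as [|N IH].
- apply is_RInt_ext with (fun t => scal (a 0%nat) (t ^ 0)).
  { intros t _; now rewrite sum_O. }
  rewrite sum_O.
  apply (is_RInt_scal (V := R_NormedModule)); apply is_RInt_pow_unit.
- apply is_RInt_ext with (fun t =>
    plus (sum_n (fun k => a k * t ^ k) N) (scal (a (S N)) (t ^ S N))).
  { intros t _; now rewrite sum_Sn. }
  rewrite sum_Sn.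
  apply (is_RInt_plus (V := R_NormedModule)); [exact IH|].
  apply (is_RInt_scal (V := R_NormedModule)); apply is_RInt_pow_unit.
Qed.

(** The mean value theorem trades [f t / t] for a value of the derivative, at a
    point where the bound is no larger than at [t].  The case [t = 0] is included
    because [0 / 0 = 0]. *)
Lemma Rabs_div_id_le (f df : R -> R) (M : R) (N : nat) (t : R) :
  0 <= t -> f 0 = 0 ->
  (forall s, 0 <= s <= t -> is_derive f s (df s)) ->
  (forall s, 0 <= s <= t -> Rabs (df s) <= M * s ^ N) ->
  0 <= M ->
  Rabs (f t / t) <= M * t ^ N.
Proof.
intros Ht f0 Hd Hb HM.
assert (Hpow := pow_le t N Ht).
destruct (Req_dec t 0) as [->|Hn].
{ rewrite f0; unfold Rdiv; rewrite Rmult_0_l, Rabs_R0; nra. }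
destruct (MVT_gen f 0 t df) as [c [Hc He]];
  rewrite ?Rmin_left, ?Rmax_right in * by lra.
- intros s Hs; apply Hd; lra.
- intros s Hs; apply continuity_pt_filterlim.
  apply (ex_derive_continuous (V := R_NormedModule)); eexists; apply Hd; lra.
- rewrite f0, !Rminus_0_r in He; rewrite He.
  replace (df c * t / t) with (df c) by (field; lra).
  apply Rle_trans with (1 := Hb c Hc).
  apply Rmult_le_compat_l; [exact HM|]; apply pow_incr; lra.
Qed.

(** Termwise integration of [f t / t], where the derivative of [f] is approximated
    by polynomials: a bound [M t ^ (N + 1)] on the derivative passes to the remainder
    of [f t / t], whose integral is then at most [M / (N + 2)].  The bound is asked
    for on the closed interval, so the power series may have radius exactly [1]. *)
Lemma is_series_RInt_div_id (f df : R -> R) (a : nat -> R) (M A : R) :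
  f 0 = 0 -> 0 <= M ->
  (forall t, 0 <= t <= 1 -> is_derive f t (df t)) ->
  (forall N t, 0 <= t <= 1 ->
     Rabs (df t - sum_n (fun k => a k * t ^ k) N) <= M * t ^ S N) ->
  is_RInt (fun t => f t / t) 0 1 A ->
  is_series (fun k => a k / INR (S k) ^ 2) A.
Proof.
intros f0 HM Hd Hb HA.
assert (Hbound : forall N,
  Rabs (A - sum_n (fun k => a k / INR (S k) ^ 2) N) <= M * / INR (S (S N))).
{ intros N.
  (* The antiderivative of the partial sum that vanishes at 0. *)
  set (p t := sum_n (fun k => a k / INR (S k) * t ^ S k) N).
  assert (Hp : forall t, is_derive p t (sum_n (fun k => a k * t ^ k) N)).
  { intros t.
    apply (is_derive_sum_n (V := R_NormedModule) (fun k t => a k / INR (S k) * t ^ S k)).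
    intros k _; assert (HS := lt_0_INR (S k) (Nat.lt_0_succ k)).
    auto_derive; [trivial|]; simpl pred; field; apply Rgt_not_eq; exact HS. }
  assert (p0 : p 0 = 0).
  { unfold p; clear; induction N as [|N IH].
    - rewrite sum_O; simpl; ring.
    - rewrite sum_Sn, IH, pow_i by lia; unfold plus; simpl; ring. }
  assert (pdiv : forall t, t <> 0 ->
            p t / t = sum_n (fun k => a k / INR (S k) * t ^ k) N).
  { intros t Ht; unfold p; clear - Ht; induction N as [|N IH].
    - rewrite !sum_O; simpl; field; lra.
    - rewrite !sum_Sn, <- IH; change plus with Rplus.
      change (t ^ S (S N)) with (t * t ^ S N).
      assert (HS := lt_0_INR (S (S N)) (Nat.lt_0_succ _)).
      field; split; lra. }
  apply (norm_RInt_le (V := R_NormedModule) (fun t => (f t - p t) / t)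
           (fun t => M * t ^ S N) 0 1); [lra| | |].
  - intros t Ht.
    apply Rabs_div_id_le with (df := fun s => df s - sum_n (fun k => a k * s ^ k) N)
                              (f := fun s => f s - p s).
    + lra.
    + rewrite f0, p0; ring.
    + intros s Hs; apply (is_derive_minus (V := R_NormedModule) f p);
        [apply Hd; lra|apply Hp].
    + intros s Hs; apply Hb; lra.
    + exact HM.
  - apply is_RInt_ext with (fun t => minus (f t / t)
        (sum_n (fun k => a k / INR (S k) * t ^ k) N)).
    { intros t; rewrite Rmin_left, Rmax_right by lra; intros Ht.
      rewrite <- pdiv by lra; unfold minus, plus, opp; simpl; field; lra. }
    apply (is_RInt_minus (V := R_NormedModule)); [exact HA|].
    assert (Hsq : forall k, a k / INR (S k) ^ 2 = a k / INR (S k) / INR (S k)).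
    { intros k; assert (HS := lt_0_INR (S k) (Nat.lt_0_succ k)); field; lra. }
    rewrite (sum_n_ext _ _ N Hsq).
    apply (is_RInt_sum_pow_unit (fun k => a k / INR (S k))).
  - apply (is_RInt_scal (V := R_NormedModule)); apply is_RInt_pow_unit. }
apply (is_lim_seq_spec _ (Finite A)).
intros eps.
destruct (nfloor_ex (M / eps)) as [n Hn].
{ apply Rdiv_le_0_compat; [exact HM|apply cond_pos]. }
exists n; intros N HN.
rewrite Rabs_minus_sym; apply Rle_lt_trans with (1 := Hbound N).
assert (HS := lt_0_INR (S (S N)) (Nat.lt_0_succ _)).
assert (He := cond_pos eps).
apply Rmult_lt_reg_r with (INR (S (S N))); [exact HS|].
rewrite Rmult_assoc, Rinv_l, Rmult_1_r by lra.
apply le_INR in HN; rewrite !S_INR.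
assert (HM' : M = M / eps * eps) by (field; lra).
rewrite HM'; nra.
Qed.

(** * The branch [log (1 + z t)] in Cartesian form *)

(** This is [|1 + z t| ^ 2] for [z = x + i y], in expanded form. *)
Definition normsq (x y t : R) : R := 1 + 2 * x * t + t ^ 2 * (x ^ 2 + y ^ 2).

Definition log_modulus (x y t : R) : R := ln (normsq x y t) / 2.

Definition log_argument (x y t : R) : R :=
  2 * atan (y * t / (1 + x * t + sqrt (normsq x y t))).

Lemma log_modulus_0 (x y : R) : log_modulus x y 0 = 0.
Proof.
unfold log_modulus, normsq.
rewrite Rmult_0_r, pow_i, Rmult_0_l, !Rplus_0_r, ln_1 by lia; field.
Qed.

Lemma log_argument_0 (x y : R) : log_argument x y 0 = 0.
Proof.
unfold log_argument; rewrite !Rmult_0_r; unfold Rdiv; rewrite Rmult_0_l, atan_0; ring.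
Qed.

(** Where [1 + x t > 0] both quantities are visibly positive.  When
    [1 + x t <= 0], being off the cut forces [y t <> 0], so the modulus strictly
    exceeds the absolute value of the real part. *)
Lemma segment_positive (x y t : R) :
  ~ (y = 0 /\ x <= -1) -> 0 <= t <= 1 ->
  0 < normsq x y t /\ 0 < 1 + x * t + sqrt (normsq x y t).
Proof.
intros Hcut Ht.
assert (HQ : normsq x y t = (1 + x * t) ^ 2 + (y * t) ^ 2) by (unfold normsq; ring).
assert (Hs := sqrt_pos (normsq x y t)).
destruct (Rlt_dec 0 (1 + x * t)) as [Hp|Hp].
{ split; [rewrite HQ; nra|lra]. }
assert (Hyt : y * t <> 0).
{ intros H; apply Rmult_integral in H; destruct H as [H|H].
  - apply Hcut; split; [exact H|].
    apply Rnot_lt_le; intros Hx.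
    destruct (Req_dec t 0) as [->|Hn]; nra.
  - subst t; lra. }
assert (H2 : 0 < (y * t) ^ 2) by (apply pow2_gt_0; exact Hyt).
split; [rewrite HQ; nra|].
assert (Rabs (1 + x * t) < sqrt (normsq x y t)); [|rewrite Rabs_left1 in *; lra].
rewrite <- sqrt_Rsqr_abs; apply sqrt_lt_1_alt; split; [apply Rle_0_sqr|].
rewrite HQ; unfold Rsqr; lra.
Qed.

Lemma is_derive_log_modulus (x y t : R) :
  0 < normsq x y t ->
  is_derive (log_modulus x y) t ((x + t * (x ^ 2 + y ^ 2)) / normsq x y t).
Proof.
unfold log_modulus, normsq; intros HQ.
auto_derive; [lra|]; field; lra.
Qed.

(** Write [s] for [|1 + z t|] and [d = 1 + x t + s].  Differentiating the arctangent
    leaves the denominator [d ^ 2 + (y t) ^ 2], which collapses to [2 s d], and a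
    numerator in which [d] also factors out; these two facts are [HE] and [HN]. *)
Lemma is_derive_log_argument (x y t : R) :
  0 < normsq x y t -> 0 < 1 + x * t + sqrt (normsq x y t) ->
  is_derive (log_argument x y) t (y / normsq x y t).
Proof.
intros HQ HD; unfold log_argument.
assert (Hs : 0 < sqrt (normsq x y t)) by (apply sqrt_lt_R0; exact HQ).
assert (Hss : sqrt (normsq x y t) * sqrt (normsq x y t) = normsq x y t)
  by (apply sqrt_def; lra).
assert (HE : (1 + x * t + sqrt (normsq x y t)) ^ 2 + (y * t) ^ 2
             = 2 * sqrt (normsq x y t) * (1 + x * t + sqrt (normsq x y t))).
{ replace ((y * t) ^ 2) with (normsq x y t - (1 + x * t) ^ 2) by (unfold normsq; ring).
  lra. }
assert (HN : 1 + x * t + sqrt (normsq x y t)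
             = (1 + x * t + sqrt (normsq x y t)) * sqrt (normsq x y t)
               - t * (x * sqrt (normsq x y t) + (x + t * (x ^ 2 + y ^ 2)))).
{ replace (t * (x * sqrt (normsq x y t) + (x + t * (x ^ 2 + y ^ 2))))
    with (t * x * sqrt (normsq x y t) + normsq x y t - (1 + x * t))
    by (unfold normsq; ring).
  lra. }
unfold normsq; auto_derive.
{ fold (normsq x y t).
  change (0 < normsq x y t /\ 1 + x * t + sqrt (normsq x y t) <> 0 /\ True).
  repeat split; lra. }
change (t * (t * 1) * (x * (x * 1) + y * (y * 1))) with (t ^ 2 * (x ^ 2 + y ^ 2)).
fold (normsq x y t).
set (s := sqrt (normsq x y t)) in *; rewrite <- Hss.
(* Scaling by [s ^ 2 / 2] exposes the two expressions simplified by [HE] and [HN]. *)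
apply Rmult_eq_reg_r with (s * s / 2); [|nra].
transitivity (y * ((1 + x * t + s) * s - t * (x * s + (x + t * (x ^ 2 + y ^ 2))))
   * s / ((1 + x * t + s) ^ 2 + (y * t) ^ 2)).
{ field. repeat split; nra. }
rewrite HE, <- HN; field; lra.
Qed.

(** With [q = b / (a + m)] and [m] the modulus, [1 + q ^ 2 = 2 m / (a + m)], so
    [cos (2 atan q) = 2 / (1 + q ^ 2) - 1 = a / m].  The angle [2 atan q] lies in
    [(- PI, PI)] and has the sign of [b], which selects the branch of [acos]. *)
Lemma Carg_half_angle (a b : R) :
  0 < a + Cmod (a, b) -> Carg (a, b) = 2 * atan (b / (a + Cmod (a, b))).
Proof.
intros HD.
assert (Hm2 : Cmod (a, b) ^ 2 = a ^ 2 + b ^ 2) by apply Cmod2_alt.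
assert (Hm : 0 < Cmod (a, b)).
{ destruct (Cmod_ge_0 (a, b)) as [H|H]; [exact H|].
  rewrite <- H in *; nra. }
unfold Carg; simpl Re; simpl Im.
set (m := Cmod (a, b)) in *.
set (q := b / (a + m)).
assert (Hq : 1 + Rsqr q = 2 * m / (a + m)).
{ unfold q, Rsqr.
  replace (1 + b / (a + m) * (b / (a + m)))
    with (((a + m) ^ 2 + b ^ 2) / (a + m) ^ 2) by (field; lra).
  replace ((a + m) ^ 2 + b ^ 2) with (2 * m * (a + m)) by lra.
  field; lra. }
assert (Hcos : a / m = cos (2 * atan q)).
{ rewrite cos_2a_cos, Rmult_assoc, cos_atan.
  replace (1 / sqrt (1 + Rsqr q) * (1 / sqrt (1 + Rsqr q))) with (/ (1 + Rsqr q)).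
  - rewrite Hq; field; lra.
  - assert (Hq1 : 0 < 1 + Rsqr q) by (pose proof (Rle_0_sqr q); lra).
    rewrite <- (sqrt_def (1 + Rsqr q)) at 1 by lra.
    pose proof (sqrt_lt_R0 _ Hq1); field; lra. }
rewrite Hcos.
pose proof (atan_bound q).
destruct (Rle_dec 0 b) as [Hb|Hb].
- assert (0 <= q) by (apply Rdiv_le_0_compat; lra).
  assert (0 <= atan q).
  { rewrite <- atan_0; destruct (Req_dec q 0) as [->|]; [lra|].
    apply Rlt_le, atan_increasing; lra. }
  apply acos_cos; lra.
- assert (q < 0).
  { unfold q, Rdiv; apply Rmult_neg_pos; [lra|]; apply Rinv_0_lt_compat; lra. }
  assert (atan q < 0) by (rewrite <- atan_0; apply atan_increasing; lra).
  rewrite <- cos_neg, acos_cos; lra.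
Qed.

Lemma Clog_segment (x y t : R) :
  ~ (y = 0 /\ x <= -1) -> 0 <= t <= 1 ->
  Clog (1 + x * t, y * t) = (log_modulus x y t, log_argument x y t).
Proof.
intros Hcut Ht.
destruct (segment_positive x y t Hcut Ht) as [HQ HD].
assert (HC : Cmod (1 + x * t, y * t) = sqrt (normsq x y t)).
{ unfold Cmod, normsq; simpl fst; simpl snd; f_equal; ring. }
unfold Clog; f_equal.
- unfold log_modulus; rewrite HC.
  rewrite <- (sqrt_sqrt (normsq x y t)) at 2 by lra.
  pose proof (sqrt_lt_R0 _ HQ); rewrite ln_mult by lra; field.
- rewrite Carg_half_angle; rewrite HC; [reflexivity|exact HD].
Qed.

(** * The dilogarithm series *)

Lemma geometric_remainder (w : C) (t : R) (N : nat) :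
  (1 - w * t <> 0)%C ->
  (w / (1 - w * t) - @sum_n C_AbelianGroup (fun k => w ^ S k * t ^ k) N
   = w ^ S (S N) * t ^ S N / (1 - w * t))%C.
Proof.
intros Hw; induction N as [|N IH].
- rewrite sum_O; simpl; field; exact Hw.
- rewrite sum_Sn; change plus with Cplus.
  transitivity (w ^ S (S N) * t ^ S N / (1 - w * t) - w ^ S (S N) * t ^ S N)%C.
  + rewrite <- IH; ring.
  + simpl; field; exact Hw.
Qed.

Lemma sum_n_C (a : nat -> C) (N : nat) :
  @sum_n C_AbelianGroup a N
  = (sum_n (fun k => Re (a k)) N, sum_n (fun k => Im (a k)) N).
Proof.
induction N as [|N IH].
- rewrite !sum_O; apply surjective_pairing.
- rewrite !sum_Sn, IH; reflexivity.
Qed.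

(** Convergence in the plane is componentwise, and the limit picked by the
    description operator is then the only one. *)
Lemma CSeries_unique (a : nat -> C) (l : C) :
  is_series (fun k => Re (a k)) (Re l) ->
  is_series (fun k => Im (a k)) (Im l) ->
  CSeries a = l.
Proof.
intros HRe HIm; unfold CSeries.
assert (Hl : @is_series R_AbsRing C_R_CompleteNormedModule a l).
{ apply filterlim_locally; intros eps.
  generalize (filter_and _ _ (proj1 (filterlim_locally _ _) HRe eps)
                (proj1 (filterlim_locally _ _) HIm eps)).
  apply filter_imp; intros N [H1 H2].
  change (ball (M := C_R_CompleteNormedModule) l eps (@sum_n C_AbelianGroup a N)).
  rewrite (sum_n_C a N); split; [exact H1|exact H2]. }
apply (iota_unique (V := C_R_CompleteNormedModule)); [|exact Hl].
intros l' Hl'.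
exact (filterlim_locally_unique (V := C_R_CompleteNormedModule) _ l' l Hl' Hl).
Qed.

(** The two components of [geometric_remainder] for [w = - z].  In the closed unit
    disc off the cut, [x > -1], and then [|1 + z t| >= 1 + x t >= min 1 (1 + x) > 0]:
    the constant is uniform in [t] and in [N]. *)
Lemma segment_remainder (x y : R) :
  Cmod (x, y) <= 1 -> ~ (y = 0 /\ x <= -1) ->
  exists M, 0 <= M /\ forall N t, 0 <= t <= 1 ->
    Rabs (- ((x + t * (x ^ 2 + y ^ 2)) / normsq x y t)
          - sum_n (fun k => Re ((- (x, y)) ^ S k)%C * t ^ k) N) <= M * t ^ S N /\
    Rabs (- (y / normsq x y t)
          - sum_n (fun k => Im ((- (x, y)) ^ S k)%C * t ^ k) N) <= M * t ^ S N.
Proof.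
intros Hmod Hcut.
assert (Hm2 : Cmod (x, y) ^ 2 = x ^ 2 + y ^ 2) by apply Cmod2_alt.
assert (Hx : -1 < x).
{ apply Rnot_le_lt; intros Hx; apply Hcut; split; [|exact Hx].
  pose proof (Cmod_ge_0 (x, y)); nra. }
assert (Hm : 0 < Rmin 1 (1 + x)) by (apply Rmin_glb_lt; lra).
exists (/ Rmin 1 (1 + x)).
split; [apply Rlt_le, Rinv_0_lt_compat, Hm|].
intros N t Ht.
assert (Hlow : Rmin 1 (1 + x) <= 1 + x * t).
{ pose proof (Rmin_l 1 (1 + x)); pose proof (Rmin_r 1 (1 + x)); nra. }
set (w := (- (x, y))%C).
assert (Hwt : (1 - w * t)%C = (1 + x * t, y * t)).
{ unfold w, Cminus, Cplus, Copp, Cmult; simpl; f_equal; ring. }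
assert (HQ : 0 < normsq x y t) by apply (segment_positive x y t Hcut Ht).
assert (Hne : (1 - w * t <> 0)%C).
{ rewrite Hwt; intros H; injection H; lra. }
assert (Hden : Rmin 1 (1 + x) <= Cmod (1 - w * t)%C).
{ rewrite Hwt; apply Rle_trans with (1 := Hlow).
  apply Rle_trans with (2 := re_le_Cmod _); apply Rle_abs. }
assert (Hrem := geometric_remainder w t N Hne).
assert (Hdiv : (w / (1 - w * t))%C =
   (- ((x + t * (x ^ 2 + y ^ 2)) / normsq x y t), - (y / normsq x y t))).
{ rewrite Hwt; unfold w, Cdiv, Cinv, Cmult, Copp; simpl fst; simpl snd.
  unfold normsq in *; f_equal; field; lra. }
assert (Hterm : forall k, (w ^ S k * t ^ k)%C =
   (Re (w ^ S k)%C * t ^ k, Im (w ^ S k)%C * t ^ k)).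
{ intros k; rewrite <- RtoC_pow; destruct (w ^ S k)%C as [a b].
  unfold Cmult, RtoC; simpl; f_equal; ring. }
assert (Hbound : Cmod (w ^ S (S N) * t ^ S N / (1 - w * t))%C
                 <= / Rmin 1 (1 + x) * t ^ S N).
{ rewrite Cmod_div, Cmod_mult, <- RtoC_pow, Cmod_R, Cmod_pow by exact Hne.
  assert (Hp := pow_le t (S N) (proj1 Ht)).
  rewrite (Rabs_pos_eq _ Hp).
  assert (Hw : Cmod w ^ S (S N) <= 1).
  { rewrite <- (pow1 (S (S N))); apply pow_incr; split; [apply Cmod_ge_0|].
    unfold w; rewrite Cmod_opp; exact Hmod. }
  unfold Rdiv; rewrite Rmult_comm; apply Rmult_le_compat.
  - apply Rlt_le, Rinv_0_lt_compat; lra.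
  - apply Rmult_le_pos; [apply pow_le, Cmod_ge_0|exact Hp].
  - apply Rinv_le_contravar; [exact Hm|exact Hden].
  - rewrite <- (Rmult_1_l (t ^ S N)) at 2.
    apply Rmult_le_compat_r; assumption. }
rewrite <- Hrem, Hdiv, sum_n_C in Hbound.
rewrite (sum_n_ext _ (fun k => Re (w ^ S k)%C * t ^ k)) in Hbound
  by (intros k; rewrite Hterm; reflexivity).
rewrite (sum_n_ext (fun k => Im (w ^ S k * t ^ k)%C) (fun k => Im (w ^ S k)%C * t ^ k))
  in Hbound by (intros k; rewrite Hterm; reflexivity).
pose proof (Rle_trans _ _ _ (Rmax_Cmod _) Hbound) as Hmax.
split; (eapply Rle_trans; [|exact Hmax]); [apply Rmax_l|apply Rmax_r].
Qed.

Lemma Cdiv_RtoC (c : C) (s : R) : s <> 0 -> (c / s)%C = (Re c / s, Im c / s).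
Proof.
intros Hs; destruct c as [a b].
unfold Cdiv, Cinv, Cmult; simpl; f_equal; field; exact Hs.
Qed.

(** In the closed unit disc this is the equality of the series with the integral;
    outside, it is the splitting of the defining integral into components. *)
Lemma Li2_opp_eq (x y A B : R) :
  ~ (y = 0 /\ x <= -1) ->
  is_RInt (fun t => log_modulus x y t / t) 0 1 A ->
  is_RInt (fun t => log_argument x y t / t) 0 1 B ->
  Li2 (- (x, y))%C = (- A, - B).
Proof.
intros Hcut HA HB.
assert (Hdmod : forall t, 0 <= t <= 1 -> is_derive (log_modulus x y) t
                 ((x + t * (x ^ 2 + y ^ 2)) / normsq x y t)).
{ intros t Ht; apply is_derive_log_modulus, (segment_positive x y t Hcut Ht). }
assert (Hdarg : forall t, 0 <= t <= 1 ->
                 is_derive (log_argument x y) t (y / normsq x y t)).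
{ intros t Ht; apply is_derive_log_argument; apply (segment_positive x y t Hcut Ht). }
unfold Li2; destruct (Rle_dec (Cmod (- (x, y))%C) 1) as [Hmod|_].
- rewrite Cmod_opp in Hmod.
  destruct (segment_remainder x y Hmod Hcut) as [M [HM Hrem]].
  assert (HS : forall k, INR (S k) ^ 2 <> 0).
  { intros k; apply pow_nonzero, not_0_INR; lia. }
  apply CSeries_unique.
  + apply is_series_ext with (fun k => Re ((- (x, y)) ^ S k)%C / INR (S k) ^ 2).
    { intros k; cbv beta; rewrite (Cdiv_RtoC _ _ (HS k)); reflexivity. }
    apply (is_series_RInt_div_id (fun t => - log_modulus x y t)
             (fun t => - ((x + t * (x ^ 2 + y ^ 2)) / normsq x y t)) _ M).
    * rewrite log_modulus_0; ring.
    * exact HM.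
    * intros t Ht; apply (is_derive_opp (V := R_NormedModule)), Hdmod, Ht.
    * intros N t Ht; apply (Hrem N t Ht).
    * apply is_RInt_ext with (fun t => opp (log_modulus x y t / t)).
      { intros t _; unfold opp; simpl; unfold Rdiv; ring. }
      apply (is_RInt_opp (V := R_NormedModule)), HA.
  + apply is_series_ext with (fun k => Im ((- (x, y)) ^ S k)%C / INR (S k) ^ 2).
    { intros k; cbv beta; rewrite (Cdiv_RtoC _ _ (HS k)); reflexivity. }
    apply (is_series_RInt_div_id (fun t => - log_argument x y t)
             (fun t => - (y / normsq x y t)) _ M).
    * rewrite log_argument_0; ring.
    * exact HM.
    * intros t Ht; apply (is_derive_opp (V := R_NormedModule)), Hdarg, Ht.
    * intros N t Ht; apply (Hrem N t Ht).
    * apply is_RInt_ext with (fun t => opp (log_argument x y t / t)).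
      { intros t _; unfold opp; simpl; unfold Rdiv; ring. }
      apply (is_RInt_opp (V := R_NormedModule)), HB.
- change (- A, - B) with (- (A, B))%C; f_equal.
  apply (is_RInt_unique (V := C_R_CompleteNormedModule)).
  apply is_RInt_ext with (fun t => (log_modulus x y t / t, log_argument x y t / t)).
  { intros t; rewrite Rmin_left, Rmax_right by lra; intros Ht.
    rewrite Cdiv_RtoC by lra.
    replace (1 + - - (x, y) * t)%C with (1 + x * t, y * t).
    - rewrite Clog_segment by (assumption || lra); reflexivity.
    - unfold Cplus, Copp, Cmult; simpl; f_equal; ring. }
  apply (is_RInt_fct_extend_pair (U := R_NormedModule) (V := R_NormedModule));
    [exact HA|exact HB].
Qed.

Lemma Li2_opp_integrals (x y : R) :
  ~ (y = 0 /\ x <= -1) ->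
  exists A B : R,
    is_RInt (fun t => ln (1 + 2 * x * t + t ^ 2 * (x ^ 2 + y ^ 2)) / (2 * t)) 0 1 A /\
    is_RInt (fun t => 2 / t * atan (y * t /
        (1 + x * t + sqrt (1 + 2 * x * t + t ^ 2 * (x ^ 2 + y ^ 2))))) 0 1 B /\
    Li2 (- (x, y))%C = (- RtoC A - Ci * RtoC B)%C.
Proof.
intros Hcut.
destruct (ex_RInt_div_id (log_modulus x y)
            (fun t => (x + t * (x ^ 2 + y ^ 2)) / normsq x y t)) as [A HA].
{ apply log_modulus_0. }
{ intros t Ht; apply is_derive_log_modulus, (segment_positive x y t Hcut Ht). }
destruct (ex_RInt_div_id (log_argument x y) (fun t => y / normsq x y t)) as [B HB].
{ apply log_argument_0. }
{ intros t Ht; apply is_derive_log_argument; apply (segment_positive x y t Hcut Ht). }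
exists A, B; split; [|split].
- apply is_RInt_ext with (2 := HA).
  intros t; rewrite Rmin_left, Rmax_right by lra; intros Ht.
  assert (Hhalf : forall p, p / 2 / t = p / (2 * t)) by (intros p; field; lra).
  apply Hhalf.
- apply is_RInt_ext with (2 := HB); intros t _.
  assert (Hcomm : forall p, 2 * p / t = 2 / t * p) by (intros p; unfold Rdiv; ring).
  apply Hcomm.
- rewrite (Li2_opp_eq x y A B Hcut HA HB).
  unfold Cminus, Cplus, Copp, Cmult, RtoC, Ci; simpl; f_equal; ring.
Qed.

Theorem proposition2 :
  forall (z : C) (x y r theta : R),
    ~ on_cut z ->
    z = (RtoC x + Ci * RtoC y)%C ->
    z = (RtoC r * (RtoC (cos theta) + Ci * RtoC (sin theta)))%C ->
    0 <= r ->
    (exists A B : R,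
       is_RInt (fun t => ln (1 + 2 * x * t + t ^ 2 * (x ^ 2 + y ^ 2)) / (2 * t)) 0 1 A /\
       is_RInt (fun t => 2 / t * atan (y * t /
           (1 + x * t + sqrt (1 + 2 * x * t + t ^ 2 * (x ^ 2 + y ^ 2))))) 0 1 B /\
       Li2 (- z)%C = (- RtoC A - Ci * RtoC B)%C) /\
    (exists A B : R,
       is_RInt (fun t => ln (1 + 2 * r * t * cos theta + t ^ 2 * r ^ 2) / (2 * t)) 0 1 A /\
       is_RInt (fun t => 2 / t * atan (r * t * sin theta /
           (1 + r * t * cos theta + sqrt (1 + 2 * r * t * cos theta + t ^ 2 * r ^ 2)))) 0 1 B /\
       Li2 (- z)%C = (- RtoC A - Ci * RtoC B)%C).
Proof.
intros z x y r theta Hcut Hcart Hpolar _.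
assert (Hz : z = (x, y)).
{ rewrite Hcart; unfold Cplus, Cmult, Ci, RtoC; simpl; f_equal; ring. }
assert (Hz' : z = (r * cos theta, r * sin theta)).
{ rewrite Hpolar; unfold Cplus, Cmult, Ci, RtoC; simpl; f_equal; ring. }
rewrite Hz in Hz'; injection Hz' as Hx Hy.
assert (Hr : r ^ 2 = x ^ 2 + y ^ 2).
{ rewrite Hx, Hy; transitivity (r ^ 2 * (Rsqr (sin theta) + Rsqr (cos theta))).
  - rewrite sin2_cos2; ring.
  - unfold Rsqr; ring. }
assert (H : ~ (y = 0 /\ x <= -1)) by (rewrite Hz in Hcut; exact Hcut).
rewrite Hz.
destruct (Li2_opp_integrals x y H) as [A [B [HA [HB HLi]]]].
split; exists A, B; (split; [|split; [|exact HLi]]).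
- exact HA.
- exact HB.
- apply is_RInt_ext with (2 := HA); intros t _.
  rewrite Hr; do 2 f_equal; rewrite Hx at 1; ring.
- apply is_RInt_ext with (2 := HB); intros t _.
  rewrite Hr.
  replace (2 * r * t * cos theta) with (2 * x * t) by (rewrite Hx; ring).
  replace (r * t * cos theta) with (x * t) by (rewrite Hx; ring).
  replace (r * t * sin theta) with (y * t) by (rewrite Hy; ring).
  reflexivity.
Qed.
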